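(* Let $N,M\ge1$ and $\tau\ge0$ be integers with $N>2\tau+M$, and let $I_1,\ldots,I_M$ be a partition of $\{0,\ldots,N-1\}$ into $M$ nonempty segments of consecutive integers. Let ${\bf F}\in\mathbb{C}^N$ be such that: (i) $\mathcal{DFT}\{{\bf F}\}$ has a compact support of length $\tau+1$; (ii) the phase of ${\bf F}$ is constant on each of the segments $I_1,\ldots,I_M$; and (iii) $|F_j|\neq0$ whenever $j$ is the first or the last index of one of the segments $I_1,\ldots,I_M$. Then the piecewise constant phase problem with data $|{\bf F}|^2$ has a unique solution up to multiplication by a global phase; that is, if ${\bf G}\in\mathbb{C}^N$ satisfies $|G_j|^2=|F_j|^2$ for all $j=0,\ldots,N-1$, $\mathcal{DFT}\{{\bf G}\}$ has a compact support of length $\tau+1$, and the phase of ${\bf G}$ is constant on each of the segments $I_1,\ldots,I_M$, then there exists $\phi\in\mathbb{R}$ such that ${\bf G}=e^{\mathrm{i}\phi}{\bf F}$.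
   Context: Vectors are indexed as ${\bf F}=(F_0,\ldots,F_{N-1})$. With $\omega_j=2\pi j/N$ and $\mathrm{i}=\sqrt{-1}$, the discrete Fourier transform is $$\mathcal{DFT}\{{\bf F}\}(k)=\frac1N\sum_{j=0}^{N-1}F_j e^{\mathrm{i}\omega_j k},\qquad k=0,\ldots,N-1.$$ A vector ${\bf f}\in\mathbb{C}^N$ has a compact support of length $\tau+1$ if there is some $\alpha\in\mathbb{Z}$ such that $f(k)=0$ for every $k\in\{0,\ldots,N-1\}$ that is not congruent modulo $N$ to an integer in $[-\alpha,-\alpha+\tau]$. The integer $\alpha$ is not assumed known, and may be different for $\mathcal{DFT}\{{\bf F}\}$ and $\mathcal{DFT}\{{\bf G}\}$; $\tau$ is known. The phase of ${\bf F}$ is constant on a segment $I_m$ if there is $a_m\in\mathbb{C}$ with $|a_m|=1$ such that $F_j=a_m|F_j|$ for all $j\in I_m$ (so an entry $F_j=0$ imposes no condition). The segmentation is known and need not be minimal: the phases $a_m$ on different segments are allowed to coincide. The piecewise constant phase problem is: given $|{\bf F}|^2$ and the segmentation, recover ${\bf F}$ among vectors whose $\mathcal{DFT}$ has compact support of length $\tau+1$ and whose phase is constant on each segment. *)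

(* Defs.v *)
From HB Require Import structures.
From mathcomp Require Import all_boot all_order all_algebra.
From mathcomp Require Import complex.
From mathcomp Require Import reals trigo.

Set Implicit Arguments.
Unset Strict Implicit.
Unset Printing Implicit Defensive.

Import Order.TTheory GRing.Theory Num.Theory.

Local Open Scope ring_scope.
Local Open Scope complex_scope.

(* e^(i t) for a real t *)
Definition expi (R : realType) (t : R) : R[i] := cos t +i* sin t.

Definition omega (R : realType) (N j : nat) : R := 2 * pi * j%:R / N%:R.

Definition DFT (R : realType) (N : nat) (F : 'rV[R[i]]_N) : 'rV[R[i]]_N :=
  \row_(k < N) (N%:R^-1 * \sum_(j < N) F 0 j * expi (omega R N j * k%:R)).

(* The support is compact in the cyclic sense: it lies in the reduction modulo
   N of the integer window [-alpha, -alpha + tau], of length tau + 1. *)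
Definition compact_support (R : realType) (N : nat) (f : 'rV[R[i]]_N)
    (tau : nat) : Prop :=
  exists alpha : int, forall k : 'I_N,
    ~ (exists l : int, - alpha <= l <= - alpha + tau%:Z /\
                       (k%:Z = l %[mod N%:Z])%Z) ->
    f 0 k = 0.

Definition consecutive (N : nat) (I : {set 'I_N}) : Prop :=
  forall i j k : 'I_N, i \in I -> k \in I -> (i <= j <= k)%N -> j \in I.

(* The blocks of a [partition] are nonempty. The block indexed by m is
   determined by its elements, so the family I_1, ..., I_M is kept as a set. *)
Definition segmentation (N M : nat) (P : {set {set 'I_N}}) : Prop :=
  [/\ partition P [set: 'I_N], #|P| = M
    & forall I, I \in P -> consecutive I].

Definition first_index (N : nat) (I : {set 'I_N}) (j : 'I_N) : Prop :=
  j \in I /\ (forall k, k \in I -> (j <= k)%N).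

Definition last_index (N : nat) (I : {set 'I_N}) (j : 'I_N) : Prop :=
  j \in I /\ (forall k, k \in I -> (k <= j)%N).

(* The norm `|z| of z : R[i] is itself an element of R[i]. *)
Definition constant_phase (R : realType) (N : nat) (F : 'rV[R[i]]_N)
    (I : {set 'I_N}) : Prop :=
  exists a : R[i], `|a| = 1 /\ (forall j, j \in I -> F 0 j = a * `|F 0 j|).

(* Main.v *)
Require Import Defs.
From HB Require Import structures.
From mathcomp Require Import all_boot all_order all_algebra.
From mathcomp Require Import complex.
From mathcomp Require Import ring lra zify.
From mathcomp Require Import reals trigo.

Set Implicit Arguments.
Unset Strict Implicit.
Unset Printing Implicit Defensive.

Import Order.TTheory GRing.Theory Num.Theory.

Local Open Scope ring_scope.
Local Open Scope complex_scope.

(** The shift between the unknown support windows of F and G is handled by a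
discrete Wronskian. Inverting the transform, a vector whose transform lives on
a cyclic window of length tau + 1 is F_j = x_j^a p(x_j), where x_j = z^j for a
primitive N-th root of unity z, a fixes the position of the window and
deg p <= tau ([compact_support_poly]); likewise G_j = x_j^b q(x_j).

On a segment both phases are constant and the moduli agree, so G is a constant
multiple of F there, whence G_(j+1) F_j = G_j F_(j+1) as soon as j and j + 1
lie in the same segment. Up to the unit x_j^(a+b), the difference of the two
sides is the value at x_j of
<<
  W(X) = z^b q(zX) p(X) - z^a q(X) p(zX),
>>
a polynomial of degree at most 2 tau, and not a polynomial times an unknown
power of X: consecutive samples shift the windows only by the scalars z^a and
z^b. With M segments there are at least N - M indices j followed by an index of
the same segment, and N - M > 2 tau, so W = 0 and the relation holds across the
segment boundaries as well ([cross_product_extends], [card_succ_in_block]).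
As F does not vanish at the ends of the segments, the ratio of G to F is then
carried from each segment to the next; this common ratio has modulus 1. *)

Lemma expiD (R : realType) (s t : R) : expi (s + t) = expi s * expi t.
Proof. by rewrite /expi cosD sinD; congr Complex; rewrite addrC. Qed.

Lemma expiMn (R : realType) (t : R) (n : nat) : expi (t *+ n) = expi t ^+ n.
Proof.
elim: n => [|n IHn]; first by rewrite mulr0n expr0 /expi cos0 sin0.
by rewrite mulrS expiD IHn exprS.
Qed.

Lemma norm1_expi (R : realType) (c : R[i]) :
  `|c| = 1 -> exists phi : R, c = expi phi.
Proof.
case: c => x y; rewrite normc_def /= => -[sq1].
have xy1 : x ^+ 2 + y ^+ 2 = 1.
  by rewrite -[LHS]sqr_sqrtr ?sq1 ?expr1n // addr_ge0 ?sqr_ge0.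
have yE : 1 - x ^+ 2 = y ^+ 2 by rewrite -xy1 addrC addKr.
have x1 : -1 <= x <= 1.
  have y2 := sqr_ge0 y; apply/andP; split; nra.
have [y0|y0] := leP 0 y.
  exists (acos x); rewrite /expi acosK ?in_itv //= sin_acos // yE sqrtr_sqr.
  by rewrite ger0_norm.
exists (- acos x); rewrite /expi cosN sinN acosK ?in_itv //= sin_acos //.
by rewrite yE sqrtr_sqr ltr0_norm // opprK.
Qed.

(** The order is exactly N: cos (2 s) = 1 forces sin s = 0, whereas
s = pi i / N lies strictly between 0 and pi when 0 < i < N. *)
Lemma expi_prim_root (R : realType) (N : nat) :
  (0 < N)%N -> N.-primitive_root (expi (2 * pi / N%:R) : R[i]).
Proof.
move=> N0; have N0R : N%:R != 0 :> R by rewrite pnatr_eq0 -lt0n.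
apply/andP; split=> //; apply/forallP=> i; apply/eqP.
rewrite unity_rootE -expiMn.
have [->|iN] := eqVneq i.+1 N.
  rewrite -[X in expi X]mulr_natr divfK // mulr_natl /expi cos2pi sin2pi.
  exact/eqP.
apply/negbTE/eqP=> -[cos1 _].
pose s : R := pi * i.+1%:R / N%:R.
have s0 : 0 < s < pi.
  rewrite /s divr_gt0 ?mulr_gt0 ?pi_gt0 ?ltr0n //=.
  rewrite ltr_pdivrMr ?ltr0n // ltr_pM2l ?pi_gt0 // ltr_nat.
  by rewrite ltn_neqAle iN ltn_ord.
have := sin_gt0_pi s0.
move: cos1; have -> : 2 * pi / N%:R *+ i.+1 = s *+ 2 :> R.
  by rewrite /s -mulr_natr -[RHS]mulr_natr; field.
rewrite cos_mulr2n cos2sin2 => cos1 sin0; nra.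
Qed.

Lemma prim_rootV (K : unitRingType) (N : nat) (z : K) :
  N.-primitive_root z -> N.-primitive_root z^-1.
Proof.
case/andP=> N0 /forallP z_prim; apply/andP; split=> //; apply/forallP=> i.
by have := z_prim i; rewrite !unity_rootE exprVn invr_eq1.
Qed.

Lemma sum_expr_unity_root (K : idomainType) (N : nat) (x : K) :
  x ^+ N = 1 -> x != 1 -> \sum_(k < N) x ^+ k = 0.
Proof.
move=> xN x1; apply/eqP; have /eqP := subrX1 x N.
by rewrite xN subrr eq_sym mulf_eq0 subr_eq0 (negbTE x1).
Qed.

Lemma DFT_inv (R : realType) (N : nat) (F : 'rV[R[i]]_N) (j : 'I_N) :
  F 0 j = \sum_(k < N) DFT F 0 k * (expi (2 * pi / N%:R))^-1 ^+ (j * k).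
Proof.
have N0 : (0 < N)%N by exact: leq_ltn_trans (ltn_ord j).
have N0C : N%:R != 0 :> R[i] by rewrite pnatr_eq0 -lt0n.
set z := expi _; have z_prim : N.-primitive_root z by exact: expi_prim_root.
have zU : z \is a GRing.unit by rewrite unitfE (prim_root_eq0 z_prim) -lt0n.
under eq_bigr => k _.
  rewrite mxE -mulrA mulr_suml.
  under eq_bigr => l _.
    have -> : omega R N l * k%:R = (2 * pi / N%:R) *+ (l * k).
      by rewrite /omega -[RHS]mulr_natr natrM; ring.
    rewrite expiMn -/z exprM (exprM z^-1) -mulrA -exprMn.
    over.
  over.
rewrite -mulr_sumr exchange_big /=.
under eq_bigr => l _ do rewrite -mulr_sumr.
rewrite (bigD1 j) //= [X in _ + X]big1 => [|l lj]; last first.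
  rewrite sum_expr_unity_root ?mulr0 //.
    rewrite exprMn -!exprM !(mulnC _ N) !exprM.
    by rewrite (prim_expr_order z_prim) (prim_expr_order (prim_rootV z_prim))
      !expr1n mulr1.
  apply: contra lj; rewrite exprVn => /eqP zlj.
  have /eqP : z ^+ l = z ^+ j.
    by apply: (divIr (unitrX j zU)); rewrite zlj divrr // unitrX.
  by rewrite (eq_prim_root_expr z_prim) !modn_small.
under eq_bigr => k _ do rewrite exprVn divrr ?unitrX // expr1n.
by rewrite sumr_const card_ord addr0 mulrCA mulVf ?mulr1.
Qed.

(** In the inversion formula, a frequency k of the window is congruent to a + t
with 0 <= t <= tau, and x ^+ k depends only on k modulo N; factoring out x ^+ a
leaves a polynomial. Working with the N-th roots x themselves lets the position
a be any representative of - alpha modulo N. *)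
Lemma compact_support_poly (R : realType) (N tau : nat) (F : 'rV[R[i]]_N) :
  (0 < N)%N -> compact_support (DFT F) tau ->
  exists (a : nat) (p : {poly R[i]}), (size p <= tau.+1)%N /\
    forall j : 'I_N, let x := (expi (2 * pi / N%:R))^-1 ^+ j in
      F 0 j = x ^+ a * p.[x].
Proof.
move=> N0 [alpha supp]; set z := expi _.
have zVN : z^-1 ^+ N = 1.
  by rewrite exprVn (prim_expr_order (expi_prim_root R N0)) invr1.
pose a := `|((- alpha) %% N%:Z)%Z|%N.
(* the position of k inside the window, when it belongs to it *)
pose t (k : 'I_N) := `|((k%:Z + alpha) %% N%:Z)%Z|%N.
exists a, (\sum_(k < N) if (t k <= tau)%N then DFT F 0 k *: 'X^(t k) else 0).
split=> [|j x].
  apply: (leq_trans (size_sum _ _ _)); apply/bigmax_leqP => k _.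
  case: ifP => [tk|_]; last by rewrite size_poly0.
  by rewrite (leq_trans (size_scale_leq _ _)) // size_polyXn.
rewrite [LHS]DFT_inv -/z horner_sum mulr_sumr; apply: eq_bigr => k _.
case: ifP => [_|/negbT]; last first.
  rewrite -ltnNge => tk.
  rewrite supp ?horner0 ?mul0r ?mulr0 // => -[l [l_itv kl]].
  suff: (t k <= tau)%N by rewrite leqNgt tk.
  have l0 : 0 <= l + alpha by lia.
  rewrite /t -modzDml kl modzDml.
  have -> : l + alpha = `|(l + alpha)%R|%N%:Z by lia.
  rewrite modz_nat absz_nat (leq_trans (leq_mod _ _)) //; lia.
rewrite hornerZ hornerXn mulrCA; congr (_ * _); rewrite -exprD exprM -/x.
have xN : x ^+ N = 1 by rewrite -exprM mulnC exprM zVN expr1n.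
rewrite -(expr_mod (a + t k) xN) -{1}(modn_small (ltn_ord k)).
congr (_ ^+ _); apply/eqP; rewrite -eqz_nat -!modz_nat PoszD.
rewrite /a /t !gez0_abs ?modz_ge0 -?lt0n //; try by rewrite eqz_nat -lt0n.
by rewrite modzDml modzDmr; apply/eqP; congr (_ %% _)%Z; lia.
Qed.

(** The identity at index j says that z ^+ j is a root of the polynomial W
below, whose degree is at most 2 * d; it therefore propagates from more than
2 * d indices to all of them. *)
Lemma cross_product_extends (K : fieldType) (N d a b : nat) (z : K)
    (p q : {poly K}) (S : {set 'I_N}) :
  N.-primitive_root z -> (size p <= d.+1)%N -> (size q <= d.+1)%N ->
  (2 * d < #|S|)%N ->
  let f j := (z ^+ j) ^+ a * p.[z ^+ j] in
  let g j := (z ^+ j) ^+ b * q.[z ^+ j] in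
  (forall j : 'I_N, j \in S -> g j.+1 * f j = g j * f j.+1) ->
  forall j : nat, g j.+1 * f j = g j * f j.+1.
Proof.
move=> z_prim sp sq dS f g Sfg.
have z0 n : z ^+ n != 0.
  rewrite expf_neq0 // (prim_root_eq0 z_prim) -lt0n.
  exact: prim_order_gt0 z_prim.
pose W := z ^+ b *: (q \Po (z *: 'X)) * p - z ^+ a *: q * (p \Po (z *: 'X)).
have WE j : g j.+1 * f j - g j * f j.+1 = (z ^+ j) ^+ (a + b) * W.[z ^+ j].
  rewrite /f /g /W !hornerE !horner_comp !hornerE exprS !exprMn exprD /=; ring.
suff W0 : W = 0 by move=> j; apply/eqP; rewrite -subr_eq0 WE W0 horner0 mulr0.
apply: contraTeq dS => W_neq0; rewrite -leqNgt.
have szW : (size W <= (2 * d).+1)%N.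
  have sdil (r : {poly K}) : size (r \Po (z *: 'X)) = size r.
    by rewrite size_comp_poly2 // size_scale ?size_polyX // -[z]expr1.
  rewrite (leq_trans (size_polyD _ _)) // geq_max size_polyN.
  have szM (r s : {poly K}) :
      (size r <= d.+1)%N -> (size s <= d.+1)%N ->
      (size (r * s)%R <= (2 * d).+1)%N.
    move=> sr ss; apply: (leq_trans (size_polyMleq r s)).
    by move: (size r) (size s) sr ss => m n; lia.
  by rewrite !szM ?sdil // (leq_trans (size_scale_leq _ _)) ?sdil.
have := @max_poly_roots _ W [seq z ^+ (i : 'I_N) | i in S] W_neq0.
rewrite size_map -cardE => roots; rewrite -ltnS (leq_trans _ szW) //.
apply: roots.
  apply/allP => _ /imageP[j jS ->]; have /eqP := WE j.
  by rewrite Sfg // subrr eq_sym mulf_eq0 expf_eq0 (negbTE (z0 _)) andbF.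
rewrite map_inj_in_uniq ?enum_uniq // => i j _ _ /eqP.
by rewrite (eq_prim_root_expr z_prim) !modn_small // => /eqP/val_inj.
Qed.

(** The block of the last index N - 1 is not continued by 0: the segments are
intervals of integers, not of the cycle, and N - 1 is always left out. *)
Definition succ_in_block (N : nat) (P : {set {set 'I_N}}) : {set 'I_N} :=
  [set j : 'I_N | [exists k : 'I_N, (k == j.+1 :> nat) && (k \in pblock P j)]].

Lemma last_index_notin_succ_in_block (N M : nat)
    (P : {set {set 'I_N}}) (j : 'I_N) :
  segmentation M P -> j \notin succ_in_block P -> last_index (pblock P j) j.
Proof.
move=> [/and3P[/eqP covP _ _] _ consP]; rewrite inE => /existsPn nj.
have jj : j \in pblock P j by rewrite mem_pblock covP inE.
split=> // k kj; rewrite leqNgt; apply/negP => jk.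
have j1 : (j.+1 < N)%N by exact: leq_ltn_trans (ltn_ord k).
have /negP := nj (Ordinal j1); rewrite eqxx /=; apply.
apply: (consP _ _ j _ k) => //=; last by rewrite leqnSn.
by apply: pblock_mem; rewrite covP inE.
Qed.

(** Each index left out is the last one of its block, so that [pblock P] is
injective on the complement. *)
Lemma card_succ_in_block (N M : nat) (P : {set {set 'I_N}}) :
  segmentation M P -> (N <= #|succ_in_block P| + M)%N.
Proof.
move=> segP; have [/and3P[/eqP covP tP _] cardP _] := segP.
rewrite -{1}(card_ord N) -(cardsC (succ_in_block P)) leq_add2l -cardP.
rewrite -(card_in_imset (f := pblock P)) => [|i j].
  apply/subset_leq_card/subsetP => _ /imsetP[j _ ->].
  by apply: pblock_mem; rewrite covP inE.
rewrite !inE => Hi Hj eq_ij; apply/val_inj/eqP; rewrite eqn_leq.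
have [ii i_last] : last_index (pblock P i) i.
  by apply: last_index_notin_succ_in_block segP _; rewrite inE.
have [jj j_last] : last_index (pblock P j) j.
  by apply: last_index_notin_succ_in_block segP _; rewrite inE.
by rewrite i_last ?j_last // -?eq_ij // eq_ij.
Qed.

Theorem theorem2 (R : realType) (N M tau : nat)
    (hN : (1 <= N)%N) (hM : (1 <= M)%N) (hNM : (2 * tau + M < N)%N)
    (P : {set {set 'I_N}}) (hP : segmentation M P)
    (F : 'rV[R[i]]_N)
    (hF_supp : compact_support (DFT F) tau)
    (hF_phase : forall I, I \in P -> constant_phase F I)
    (hF_ends : forall (I : {set 'I_N}) (j : 'I_N), I \in P ->
       first_index I j \/ last_index I j -> `|F 0 j| <> 0)
    (G : 'rV[R[i]]_N)
    (hG_mod : forall j : 'I_N, `|G 0 j| ^+ 2 = `|F 0 j| ^+ 2)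
    (hG_supp : compact_support (DFT G) tau)
    (hG_phase : forall I, I \in P -> constant_phase G I) :
  exists phi : R, G = expi phi *: F.
Proof.
have covP : cover P = [set: 'I_N] by case: hP => /and3P[/eqP].
have jj (j : 'I_N) : j \in pblock P j by rewrite mem_pblock covP inE.
have blkP (j : 'I_N) : pblock P j \in P by rewrite pblock_mem // covP inE.
have eqFG (j : 'I_N) : `|G 0 j| = `|F 0 j|.
  by apply/eqP; rewrite -(eqrXn2 (n := 2)) // hG_mod.
have ratio (j : 'I_N) :
    exists c : R[i], forall k, k \in pblock P j -> G 0 k = c * F 0 k.
  have [a [a1 aF]] := hF_phase _ (blkP j).
  have [b [b1 bG]] := hG_phase _ (blkP j).
  have a0 : a != 0 by rewrite -normr_eq0 a1 oner_eq0.
  by exists (b / a) => k kj; rewrite bG // aF // eqFG mulrA divfK.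
have nz_last (j : 'I_N) : j \notin succ_in_block P -> F 0 j != 0.
  move=> /(last_index_notin_succ_in_block hP) jl.
  apply/eqP => Fj; apply: (hF_ends _ _ (blkP j) (or_intror jl)).
  by rewrite Fj normr0.
have nz_first (j : 'I_N) :
    exists k : 'I_N, [/\ k \in pblock P j, (k <= j)%N & F 0 k != 0].
  case: (arg_minnP (fun k : 'I_N => k : nat) (jj j)) => k kj kmin.
  exists k; split=> //; first exact: (kmin j (jj j)).
  apply/eqP => Fk; apply: (hF_ends _ k (blkP j)); last by rewrite Fk normr0.
  by left.
have [a [p [sp Fp]]] := compact_support_poly hN hF_supp.
have [b [q [sq Gq]]] := compact_support_poly hN hG_supp.
have cross (i j : 'I_N) : j = i.+1 :> nat -> G 0 j * F 0 i = G 0 i * F 0 j.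
  move=> ji; rewrite !Fp !Gq ji.
  apply: (@cross_product_extends _ N tau a b _ p q (succ_in_block P)) => //.
  - exact: prim_rootV (expi_prim_root R hN).
  - by have := card_succ_in_block hP; lia.
  move=> k; rewrite inE => /existsP[l /andP[/eqP lk lP]].
  have [c cE] := ratio k.
  by rewrite -lk -!Fp -!Gq !cE //; ring.
pose o : 'I_N := Ordinal hN.
have Fo : F 0 o != 0.
  have [k [_]] := nz_first o.
  by rewrite leqn0 => /eqP k0; have -> : k = o by exact: val_inj.
pose c := G 0 o / F 0 o.
have GcF (j : 'I_N) : G 0 j = c * F 0 j.
  case: j => n; elim/ltn_ind: n => -[|n] IHn nN.
    have -> : Ordinal nN = o by exact: val_inj.
    by rewrite /c divfK.
  set j := Ordinal nN; pose i := Ordinal (ltnW nN).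
  have IHi : G 0 i = c * F 0 i by exact: IHn.
  (* At a segment boundary the cross product transports the ratio through
     F_i <> 0. Inside a segment F_i may vanish, and the ratio is read off at the
     first index of the segment instead. *)
  have [iP|/nz_last Fi] := boolP (i \in succ_in_block P); last first.
    by apply: (mulIf Fi); rewrite (cross i j) // IHi mulrAC.
  have ji : j \in pblock P i.
    move: iP; rewrite inE => /existsP[l /andP[/eqP lE]].
    by have -> : l = j by exact: val_inj.
  have [d dE] := ratio i; have [k [ki kn Fk]] := nz_first i.
  have -> : c = d.
    have kN := ltn_ord k; apply: (mulIf Fk); rewrite -dE //.
    by case: k kn {ki Fk kN} => m mN mn; rewrite IHn.
  exact: dE.
have c1 : `|c| = 1 by rewrite normrM normfV eqFG divff // normr_eq0.
have [phi cphi] := norm1_expi c1.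
by exists phi; apply/rowP => j; rewrite mxE -cphi.
Qed.
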